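(* Let $n\ge 2$ and let $A=(a_{ij})_{1\le i,j\le n}$ be the general $n\times n$ matrix, whose entries $a_{ij}$ are $n^2$ independent commuting indeterminates. Let $S\subseteq\{(i,j)\mid 1\le i,j\le n,\ i\ne j\}$ be any set of $n$ non-diagonal positions. Then there exist polynomials $q_s\in\mathbb{Q}[a_{ij}: 1\le i,j\le n]$, $s\in S$, not all zero and independent of $m$, such that $$\sum_{s\in S} q_s\cdot (A^m)_s=0$$ for all integers $m>1$.
   Context: For a matrix $B$ and a position $s=(i,j)$, $B_s=B_{ij}$ denotes the $(i,j)$ entry of $B$. The polynomials $q_s$ may depend on $n$ and $S$ but not on the exponent $m$. *)

(* Defs.v *)
From HB Require Import structures.
From mathcomp Require Import all_boot all_order all_algebra.
From mathcomp Require Import mpoly.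

Set Implicit Arguments.
Unset Strict Implicit.
Unset Printing Implicit Defensive.

Import GRing.Theory.
Local Open Scope ring_scope.

(* The indeterminate a_(i,j) is the variable number [mxvec_index i j] of
   Q[X_0, ..., X_(n * n - 1)]; [mxvec_index] is a bijection from pairs of
   indices onto 'I_(n * n), so the n ^ 2 entries are distinct variables. *)
Definition general_matrix (n : nat) : 'M[{mpoly rat[n * n]}]_n :=
  \matrix_(i < n, j < n) 'X_(mxvec_index i j).

(* Main.v *)
Require Import Defs.
From HB Require Import structures.
From mathcomp Require Import all_boot all_order all_algebra.
From mathcomp Require Import mpoly.

Set Implicit Arguments.
Unset Strict Implicit.
Unset Printing Implicit Defensive.

Import GRing.Theory.
Local Open Scope ring_scope.

(** By Cayley-Hamilton, [exprmx_lin_comb] writes each power of an n by n matrix A as a combination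
    of I, A, ..., A^(n-1). A relation among the entries at S valid for these n powers thus holds for
    all. That is n linear equations in n unknowns q_s, and the one for I is trivial off the
    diagonal, so a nonzero solution exists. *)

Lemma exprmx_lin_comb (R : comNzRingType) (n : nat) (A : 'M[R]_n.+1) (m : nat) :
  exists c : 'I_n.+1 -> R, A ^+ m = \sum_i c i *: A ^+ i.
Proof.
have monP := char_poly_monic A.
(* The characteristic polynomial is monic, so this division needs no field; the coefficients of the
   remainder are the [c i]. *)
pose r := Pdiv.Ring.rmodp 'X^m (char_poly A).
have szr : (size r <= n.+1)%N.
  by rewrite -ltnS -(size_char_poly A) Pdiv.Ring.ltn_rmodpN0 ?monic_neq0.
exists (fun i => r`_i).
transitivity (horner_mx A r).
  rewrite -[in LHS](horner_mx_X A) -rmorphXn /=.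
  rewrite (Pdiv.RingMonic.rdivp_eq monP 'X^m).
  by rewrite rmorphD rmorphM /= Cayley_Hamilton mulr0 add0r.
have {1}-> : r = \sum_(i < n.+1) r`_i *: 'X^i.
  rewrite -poly_def; apply/polyP => i; rewrite coef_poly.
  by case: ltnP => // /(leq_trans szr)/(nth_default 0)->.
rewrite rmorph_sum /=; apply: eq_bigr => i _.
by rewrite horner_mxZ rmorphXn /= horner_mx_X.
Qed.

(* The powers [A ^+ i] with [i <= n] span all powers of [A], and the power [i = 0]
   vanishes off the diagonal; hence the determinant below has a zero column. *)
Lemma offdiag_exprmx_lin_rel (R : idomainType) (n : nat) (A : 'M[R]_n.+1)
    (S : {set 'I_n.+1 * 'I_n.+1}) :
    (forall s, s \in S -> s.1 != s.2) -> #|S| = n.+1 ->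
  exists2 q : 'I_n.+1 * 'I_n.+1 -> R, (exists2 s, s \in S & q s != 0)
    & forall m, \sum_(s in S) q s * (A ^+ m) s.1 s.2 = 0.
Proof.
move=> hoff hcard.
have [s0 s0S] : exists s0, s0 \in S by apply/set0Pn; rewrite -card_gt0 hcard.
(* Numbering S by ['I_n.+1] makes [M] below square. *)
pose rank s := cast_ord hcard (enum_rank_in s0S s).
pose val k := enum_val (cast_ord (esym hcard) k).
have rankK : {in S, cancel rank val}.
  by move=> s sS; rewrite /rank /val cast_ordK enum_rankK_in.
have valK : cancel val rank.
  by move=> k; rewrite /rank /val enum_valK_in cast_ordKV.
have valS k : val k \in S by apply: enum_valP.
pose M := \matrix_(k < n.+1, i < n.+1) (A ^+ i) (val k).1 (val k).2.
(* Over an integral domain a singular matrix has a nonzero left kernel vector with entries in [R]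
   itself, so no denominators arise. *)
have /det0P[v v0 vM] : \det M == 0.
  rewrite (expand_det_col _ ord0) big1 // => k _.
  by rewrite mxE expr0 mxE (negPf (hoff _ (valS k))) mul0r.
exists (fun s => v 0 (rank s)).
  have [k vk] := rV0Pn _ v0.
  by exists (val k); rewrite ?valS ?valK.
move=> m; have [c ->] := exprmx_lin_comb A m.
(* Only [c] depends on [m]; [v] was fixed before. *)
transitivity (\sum_i c i * (v *m M) 0 i); last first.
  by rewrite big1 // => i _; rewrite vM mxE mulr0.
under [RHS]eq_bigr => i _ do rewrite mxE mulr_sumr.
rewrite exchange_big /= (reindex_onto val rank rankK) /=.
apply: eq_big => [k|k _]; first by rewrite valS valK eqxx.
rewrite valK summxE mulr_sumr; apply: eq_bigr => i _.
by rewrite !mxE mulrCA.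
Qed.

Theorem mainTheorem2 (n : nat) (hn : (2 <= n)%N)
    (S : {set 'I_n * 'I_n})
    (hoff : forall s : 'I_n * 'I_n, s \in S -> s.1 != s.2)
    (hcard : #|S| = n) :
  exists q : 'I_n * 'I_n -> {mpoly rat[n * n]},
    (exists2 s : 'I_n * 'I_n, s \in S & q s != 0) /\
    (forall m : nat, (1 < m)%N ->
       \sum_(s in S) q s * (general_matrix n ^+ m) s.1 s.2 = 0).
Proof.
case: n hn S hoff hcard => [//|n] _ S hoff hcard.
have [q q0 qA] := offdiag_exprmx_lin_rel (general_matrix n.+1) hoff hcard.
by exists q.
Qed.
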